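(* If $q > 3$ is a prime, then $\chi_a(\mathcal{U}(\mathbb{Z}_{3q})) = \frac{3q+1}{2}$.
   Context: For a finite ring $R$ with unity and unit group $R^*$, the unitary addition Cayley graph $\mathcal{U}(R)$ is the simple graph with vertex set $R$ in which distinct vertices $x,y$ are adjacent if and only if $x+y \in R^*$; $\mathbb{Z}_n$ is the ring of integers modulo $n$. The achromatic number $\chi_a(G)$ of a graph $G$ is the maximum number of colors in a proper vertex coloring of $G$ such that for every pair of distinct color classes there is at least one edge of $G$ joining a vertex of one class to a vertex of the other. *)

(* Defs.v *)
From HB Require Import structures.
From mathcomp Require Import all_boot all_order all_algebra.

Set Implicit Arguments.
Unset Strict Implicit.
Unset Printing Implicit Defensive.

Import GRing.Theory.

(* A simple graph is a symmetric irreflexive relation on its vertex type. *)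

Section Achromatic.

Variables (T : finType) (e : rel T).

Definition proper_coloring k (c : {ffun T -> 'I_k}) : bool :=
  [forall x, forall y, e x y ==> (c x != c y)].

(* The first clause says that exactly k colors occur; it is implied by the last
   one except when k = 1. *)
Definition complete_coloring k (c : {ffun T -> 'I_k}) : bool :=
  [&& [forall i, exists x, c x == i],
      proper_coloring c &
      [forall i, forall j, (i != j) ==>
        [exists x, exists y, [&& c x == i, c y == j & e x y]]]].

Lemma complete_coloring_card k (c : {ffun T -> 'I_k}) :
  complete_coloring c -> k <= #|T|.
Proof.
case/and3P=> /forallP surj _ _; rewrite -[k in k <= _]card_ord.
have <- : #|codom c| = #|'I_k|.
  by apply: eq_card => i; have /existsP[x /eqP <-] := surj i; rewrite codom_f.
exact: leq_image_card.
Qed.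

(* The range k <= #|T| loses nothing, by complete_coloring_card. *)
Definition achromatic_number : nat :=
  \max_(k < #|T|.+1 | [exists c : {ffun T -> 'I_k}, complete_coloring c]) k.

End Achromatic.

Section UnitaryAdditionCayley.

Variable R : finUnitRingType.

Definition unitary_addition_cayley : rel R :=
  fun x y => (x != y) && ((x + y)%R \is a GRing.unit).

Lemma unitary_addition_cayley_sym : symmetric unitary_addition_cayley.
Proof. by move=> x y; rewrite /unitary_addition_cayley eq_sym addrC. Qed.

Lemma unitary_addition_cayley_irr : irreflexive unitary_addition_cayley.
Proof. by move=> x; rewrite /unitary_addition_cayley eqxx. Qed.

End UnitaryAdditionCayley.

Arguments unitary_addition_cayley R : clear implicits.

(* Main.v *)
Require Import Defs.
From mathcomp Require Import all_boot all_order all_algebra zify.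

Set Implicit Arguments.
Unset Strict Implicit.
Unset Printing Implicit Defensive.

Import GRing.Theory.

(** By the Chinese remainder theorem the graph is a relation on 'I_3 * F with F
of odd order q, where distinct u and v are adjacent when both coordinates of u
+ v are nonzero.
Upper bound: let s be the number of singleton color classes. If s <= 1 then 2k
<= 3q + s. Otherwise the singletons are pairwise adjacent, so some singleton v
has first coordinate nonzero. The class of (0, - v.2) then lies in row 0, and
row 0 being independent, there is only one such class, hence all singletons lie
in the row of v. The class in row 0 contains (0, - w.2) for each singleton w,
so it has at least s elements, which makes up for the s singletons: 3q >= s + s
+ 2(k - s - 1), and 3q is odd.
Lower bound: with q = 2h + 1, take the classes {(1, u), (2, u - h)} for 0 <= u
<= h, and for each x in F the class of (0, - x), (1, x) if x > h, and (2, x) if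
0 < x <= h. *)

(** * Complete colorings and bounds on the achromatic number *)

Lemma complete_coloringP (T : finType) (e : rel T) k (c : {ffun T -> 'I_k}) :
  reflect [/\ forall i, exists x, c x = i,
              forall x y, e x y -> c x <> c y &
              forall i j, i <> j -> exists x y, [/\ c x = i, c y = j & e x y]]
          (complete_coloring e c).
Proof.
apply: (iffP and3P) => -[surj prop adj]; split.
- by move=> i; have /existsP[x /eqP] := forallP surj i; exists x.
- move=> x y exy; apply/eqP.
  by move/forallP/(_ x)/forallP/(_ y)/implyP: prop; apply.
- move=> i j /eqP neq_ij.
  move/forallP/(_ i)/forallP/(_ j)/implyP/(_ neq_ij): adj.
  by case/existsP=> x /existsP[y /and3P[/eqP ? /eqP ? ?]]; exists x, y.
- by apply/forallP=> i; have [x /eqP cx] := surj i; apply/existsP; exists x.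
- apply/forallP=> x; apply/forallP=> y; apply/implyP=> exy.
  exact/eqP/prop.
- apply/forallP=> i; apply/forallP=> j; apply/implyP=> /eqP /adj.
  case=> x [y [/eqP cx /eqP cy exy]].
  by apply/existsP; exists x; apply/existsP; exists y; apply/and3P.
Qed.

Lemma achromatic_number_max (T : finType) (e : rel T) k (c : {ffun T -> 'I_k}) :
  complete_coloring e c -> k <= achromatic_number e.
Proof.
move=> cc; have lt_k : k < #|T|.+1 := complete_coloring_card cc.
apply: (@leq_bigmax_cond _ _ (@nat_of_ord _) (Ordinal lt_k)).
by apply/existsP; exists c.
Qed.

Lemma achromatic_number_leP (T : finType) (e : rel T) m :
  (forall k (c : {ffun T -> 'I_k}), complete_coloring e c -> k <= m) ->
  achromatic_number e <= m.
Proof. by move=> le_m; apply/bigmax_leqP=> k /existsP[c /le_m]. Qed.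

Lemma achromatic_number_iso (T T' : finType) (e : rel T) (e' : rel T')
    (f : T -> T') :
  bijective f -> (forall x y, e x y = e' (f x) (f y)) ->
  achromatic_number e = achromatic_number e'.
Proof.
move=> [g fK gK] ef; apply/eqP; rewrite eqn_leq; apply/andP; split.
  apply: achromatic_number_leP => k c /complete_coloringP[surj prop adj].
  apply: (@achromatic_number_max _ _ _ [ffun x => c (g x)]).
  apply/complete_coloringP; split=> [i | x y | i j /adj[x [y [<- <-]]]].
  - by have [x <-] := surj i; exists (f x); rewrite ffunE fK.
  - by rewrite !ffunE -{1}[x]gK -{1}[y]gK -ef => /prop.
  - by rewrite ef; exists (f x), (f y); rewrite !ffunE !fK.
apply: achromatic_number_leP => k c /complete_coloringP[surj prop adj].
apply: (@achromatic_number_max _ _ _ [ffun x => c (f x)]).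
apply/complete_coloringP; split=> [i | x y | i j /adj[x [y [<- <-]]]].
- by have [x <-] := surj i; exists (g x); rewrite ffunE gK.
- by rewrite !ffunE ef => /prop.
- by exists (g x), (g y); rewrite !ffunE ef !gK.
Qed.

Lemma leq_achromatic_number (T K : finType) (e : rel T) (f : T -> K) :
  (forall i, exists x, f x = i) -> (forall x y, e x y -> f x <> f y) ->
  (forall i j, i <> j -> exists x y, [/\ f x = i, f y = j & e x y]) ->
  #|K| <= achromatic_number e.
Proof.
move=> surj prop adj.
apply: (@achromatic_number_max _ _ _ [ffun x => enum_rank (f x)]).
apply/complete_coloringP; split=> [i | x y | i j neq_ij].
- by have [x fx] := surj (enum_val i); exists x; rewrite ffunE fx enum_valK.
- by rewrite !ffunE => /prop + /enum_rank_inj.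
- have [|x [y [fx fy exy]]] := adj (enum_val i) (enum_val j).
    by move/enum_val_inj.
  by exists x, y; rewrite !ffunE fx fy !enum_valK.
Qed.

(** Modulo a prime the units are the nonzero elements, so addition alone describes the graph and an
    additive group [F] suffices. *)
Definition sum_nonzero (F : finZmodType) : rel ('I_3 * F) :=
  fun u v => [&& u != v, (u.1 + v.1)%R != 0%R & (u.2 + v.2)%R != 0%R].

(** * Upper bound: counting vertices by color class *)

Section UpperBound.

Variables (F : finZmodType) (k : nat) (c : {ffun 'I_3 * F -> 'I_k}).
Hypothesis cc : complete_coloring (@sum_nonzero F) c.

Let surj i : exists x, c x = i.
Proof. by case/complete_coloringP: cc. Qed.

Let adj i j : i <> j -> exists x y, [/\ c x = i, c y = j & sum_nonzero x y].
Proof. by case/complete_coloringP: cc => _ _; apply. Qed.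

Let indep u v : c u = c v ->
  [\/ u = v, (u.1 + v.1)%R = 0%R | (u.2 + v.2)%R = 0%R].
Proof.
case/complete_coloringP: cc => _ + _ => /(_ u v) prop cuv.
move: prop; rewrite /sum_nonzero.
case: eqP => [-> _|_]; first by constructor 1.
case: eqP => [-> _|_]; first by constructor 2.
by case: eqP => [-> _|_ /(_ isT)//]; constructor 3.
Qed.

Let singles := [set x | [forall y, (c y == c x) ==> (y == x)]].

Let singlesP x y : x \in singles -> c y = c x -> y = x.
Proof. by rewrite inE => /forallP/(_ y)/implyP + /eqP => /[apply]/eqP. Qed.

Let singles_adj x y :
  x \in singles -> y \in singles -> x <> y -> sum_nonzero x y.
Proof.
move=> Sx Sy neq; have [|u [v [cu cv]]] := @adj (c x) (c y).
  by move/(singlesP Sy).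
by rewrite (singlesP Sx cu) (singlesP Sy cv).
Qed.

(** No edge joins two vertices of row 0, so completeness leaves room for only one class inside that
    row. *)
Let zero_row_color u v :
  (forall w, c w = c u -> w.1 = 0%R) -> (forall w, c w = c v -> w.1 = 0%R) ->
  c u = c v.
Proof.
move=> u0 v0; apply/eqP/negP => /negP/eqP /adj[x [y [/u0 x0 /v0 y0]]].
by rewrite /sum_nonzero x0 y0 addr0 eqxx andbF.
Qed.

Let I3_cases (a b : 'I_3) : (a != 0 -> [\/ b = 0, b = a | b = - a])%R.
Proof.
by case: a b => [[|[|[|]]]] //= ? [[|[|[|]]]] //= ? _;
  (constructor 1 + constructor 2 + constructor 3); apply/val_inj.
Qed.

(** Write [p] for [(0, - v.2)]. If [w.1] is nonzero, independence from [p] forces [w.2 = v.2]. Then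
    [w.1 = v.1] would give [w = v], whose class does not contain [p], while [w.1 = - v.1] would
    leave [v] without a neighbor in the class of [p]. *)
Let zero_row_class v w : v \in singles -> v.1 != 0%R ->
  c w = c (0%R, - v.2)%R -> w.1 = 0%R.
Proof.
set p := (0%R, _) => Sv v1_neq0.
have not_v z : c z = c p -> z <> v.
  move=> cz zv; have : p = v by apply: singlesP; rewrite // -cz zv.
  by move/(congr1 fst)=> /= v0; rewrite -v0 eqxx in v1_neq0.
move=> cw.
case: (I3_cases w.1 v1_neq0) => // w1; first last.
- have w2 : w.2 = v.2.
    case: (indep cw) => /= [ww | | /subr0_eq //].
      by move: w1; rewrite ww => /esym/eqP; rewrite oppr_eq0 (negPf v1_neq0).
    by rewrite w1 addr0 => /eqP; rewrite oppr_eq0 (negPf v1_neq0).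
  have [|x [y [cx cy]]] := @adj (c v) (c p).
    by move=> cv; apply: (not_v v).
  rewrite (singlesP Sv cx) {x cx} => /and3P[_ vy1 vy2].
  (* The neighbor [y] of [v] is not in row [- v.1]. In row 0, independence from [w] gives
     [y.2 = - v.2]; in row [v.1], independence from [p] gives [y = v]. Both are impossible. *)
  case: (I3_cases y.1 v1_neq0) => y1; last by rewrite y1 subrr eqxx in vy1.
  + have cyw : c y = c w by rewrite cy cw.
    case: (indep cyw) => [yw | | ].
    * by move: w1; rewrite -yw y1 => /esym/eqP; rewrite oppr_eq0 (negPf v1_neq0).
    * by rewrite y1 w1 add0r => /eqP; rewrite oppr_eq0 (negPf v1_neq0).
    * by rewrite w2 addrC => y2; rewrite y2 eqxx in vy2.
  + case: (indep cy) => /= [yp | | ].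
    * by move: y1; rewrite yp /= => /esym/eqP; rewrite (negPf v1_neq0).
    * by rewrite y1 addr0 => /eqP; rewrite (negPf v1_neq0).
    * move/subr0_eq=> y2; case: (not_v y cy).
      by rewrite [y]surjective_pairing y1 y2 -surjective_pairing.
- case: (indep cw) => /= [ww | | /subr0_eq w2].
  + by rewrite ww.
  + by rewrite addr0.
  + by case: (not_v w cw); rewrite [w]surjective_pairing w1 w2 -surjective_pairing.
Qed.

Let large_class : 1 < #|singles| -> exists d, #|singles| <= #|[set x | c x == d]|.
Proof.
case/card_gt1P=> x [y [Sx Sy neq_xy]].
have [v Sv v1] : exists2 v, v \in singles & v.1 != 0%R.
  have /and3P[_ + _] := singles_adj Sx Sy (elimN eqP neq_xy).
  have [-> |] := eqVneq x.1 0%R; last by exists x.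
  by rewrite add0r; exists y.
exists (c (0%R, - v.2)%R).
(* A singleton [w] in row 0 would have to be [(0, - v.2)], which is not adjacent to [v]; neither is
   anything in row [- v.1]. *)
have row w : w \in singles -> w.1 = v.1.
  move=> Sw; have [<- // | /eqP neq_wv] := eqVneq w v.
  have /and3P[_ wv1 wv2] := singles_adj Sw Sv neq_wv.
  case: (I3_cases w.1 v1) => // w1; last by rewrite w1 addNr eqxx in wv1.
  have /(singlesP Sw) pw : c (0%R, - v.2)%R = c w.
    apply: zero_row_color => u; first exact: zero_row_class.
    by move/(singlesP Sw)->.
  by rewrite -pw addNr eqxx in wv2.
(* Since the singletons share a row, [f] is injective on them; each image has its class inside row
   0, so all images have the same color. *)
pose f (u : 'I_3 * F) : 'I_3 * F := (0%R, - u.2)%R.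
have injf : {in singles &, injective f}.
  move=> u w /row u1 /row w1 [/oppr_inj u2].
  by rewrite [u]surjective_pairing [w]surjective_pairing u1 w1 u2.
rewrite -(card_in_imset injf); apply/subset_leq_card/subsetP=> _ /imsetP[u Su ->].
rewrite inE; apply/eqP/zero_row_color => w; last exact: zero_row_class.
by apply: zero_row_class => //; rewrite (row u Su).
Qed.

(** Counting each singleton twice gives every class weight at least 2. *)
Let sum_classes :
  \sum_(i < k) \sum_(x | c x == i) (1 + (x \in singles)) = 3 * #|F| + #|singles|.
Proof.
transitivity (\sum_x (1 + (x \in singles))).
  by rewrite [RHS](partition_big c xpredT).
rewrite big_split /= sum1_card card_prod card_ord; congr (_ + _).
by rewrite -big_mkcond sum1_card.
Qed.

Let sum_class_ge2 i : 2 <= \sum_(x | c x == i) (1 + (x \in singles)).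
Proof.
have [x cx] := surj i; rewrite (bigD1 x) ?cx //=.
have [_|] := boolP (x \in singles); first by rewrite -addnA.
rewrite inE negb_forall => /existsP[y]; rewrite negb_imply => /andP[cy neq_yx].
by rewrite (bigD1 y) -?cx ?cy //=; lia.
Qed.

Lemma complete_coloring_leq : odd #|F| -> 2 * k <= 3 * #|F| + 1.
Proof.
move=> oddF; have [le1 | gt1] := leqP #|singles| 1.
  have : \sum_(i < k) 2 <= 3 * #|F| + #|singles|.
    by rewrite -sum_classes; apply: leq_sum => i _.
  by rewrite sum_nat_const card_ord; lia.
have [d le_d] := large_class gt1.
(* With s singletons, s >= 2, class [d] weighs at least s = 2 + (s - 2). Hence 2k + s - 2 <= 3m + s
   for m = [#|F|], and since 3m is odd, 2k <= 3m + 2 improves to 2k <= 3m + 1. *)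
have : \sum_(i < k) (2 + (if i == d then #|singles| - 2 else 0))
       <= 3 * #|F| + #|singles|.
  rewrite -sum_classes; apply: leq_sum => i _; case: eqP => [->|_]; last first.
    by rewrite addn0.
  rewrite subnKC //; apply: leq_trans le_d _.
  rewrite -sum1dep_card; apply: leq_sum => x _; exact: leq_addr.
rewrite big_split /= sum_nat_const card_ord -big_mkcond big_pred1_eq.
move: gt1 (odd_double_half #|F|); rewrite oddF.
by move: #|singles| #|F| => s m; lia.
Qed.

End UpperBound.

(** * Lower bound: an explicit complete coloring *)

Section LowerBound.

Variable h : nat.
Hypothesis h_gt0 : 0 < h.

Let n := h.*2.+1.
(** [inl x] is the color of [(0, - x)] and [inr u] that of the pair in rows 1 and 2, for 3h + 2
    colors in all. *)
Let color : finType := ('I_n + 'I_h.+1)%type.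

(** Adding [shift a] in row [a] sends both [(1, u)] and [(2, u - h)] to second coordinate [u]. Row 2
    also appears as row [- 1]. *)
Let shift (a : 'I_3) : 'I_n := if a == 1%R then 0%R else inZp h.

Let shift_N1 : shift (- 1)%R = inZp h.
Proof. by []. Qed.

Let f (u : 'I_3 * 'I_n) : color :=
  if u.1 == 0%R then inl (- u.2)%R
  else let y := (u.2 + shift u.1)%R in
       if y <= h then inr (inord y) else inl u.2.

Let add_distinct_nonzero (a b : 'I_3) :
  (a != 0 -> b != 0 -> a != b -> a + b = 0)%R.
Proof. by case: a b => [[|[|[|]]]] //= ? [[|[|[|]]]] //= ? *; apply/val_inj. Qed.

(** Distinct nonzero rows sum to 0 and row 0 is independent. Within a nonzero row [f] is injective,
    and across row 0 equal colors mean opposite second coordinates. *)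
Let f_proper u v : sum_nonzero u v -> f u <> f v.
Proof.
case: u v => [a x] [b y] /and3P[/= neq ab xy]; rewrite /f /=.
case: (eqVneq a 0%R) ab neq => [-> | a0]; case: (eqVneq b 0%R) => [-> | b0].
- by rewrite addr0.
- move=> _ _; case: ifP => // _ [yx].
  by rewrite -yx subrr eqxx in xy.
- move=> _ _; case: ifP => // _ [yx].
  by rewrite yx addNr eqxx in xy.
have [<- | /(add_distinct_nonzero a0 b0) ->] := eqVneq a b; last by rewrite eqxx.
move=> _ neq; case: ifP => [xh | _]; case: ifP => [yh | _] //.
- move=> [/(congr1 val)]; rewrite /= !inordK ?ltnS // => xy_val.
  have eq_xy : x = y by apply: (@addIr _ (shift a)); apply: val_inj.
  by rewrite eq_xy eqxx in neq.
- by move=> [eq_xy]; rewrite eq_xy eqxx in neq.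
Qed.

Let f_zero x : f (0%R, - x)%R = inl x.
Proof. by rewrite /f /= opprK. Qed.

Let f_nonzero a x : a != 0%R ->
  f (a, x) = if (x + shift a)%R <= h then inr (inord (x + shift a)%R) else inl x.
Proof. by rewrite /f /= => /negPf ->. Qed.

Let f_inr (a : 'I_3) (u : 'I_h.+1) :
  a != 0%R -> f (a, inZp u - shift a)%R = inr u.
Proof.
move=> a0; rewrite f_nonzero // subrK /=.
have un : u %% n = u by rewrite modn_small // /n; have := ltn_ord u; lia.
by rewrite un -ltnS ltn_ord inord_val.
Qed.

(** Row 1 serves for y > h; row 2 serves for 0 < y <= h, where h < y + h <= 2h does not wrap around.
    At 0 this fails: [(1, 0)] and [(2, 0)] have colors [inr 0] and [inr h]. *)
Let f_inl (y : 'I_n) : y != 0%R -> exists2 a, a != 0%R & f (a, y) = inl y.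
Proof.
move=> y0; have [yh | hy] := leqP y h; last first.
  by exists 1%R; rewrite // f_nonzero // /shift eqxx addr0 leqNgt hy.
exists (- 1)%R => //; rewrite f_nonzero // shift_N1 ifF //=.
have y_gt0 : 0 < y by rewrite lt0n.
have hn : h %% n = h by rewrite modn_small // /n; lia.
rewrite hn modn_small.
  by rewrite -[leqRHS]add0n leq_add2r leqNgt y_gt0.
by rewrite ltnS (leq_trans (leq_add yh (leqnn h))) ?addnn.
Qed.

Let sum_nonzero_zero (a : 'I_3) (x y : 'I_n) : a != 0%R ->
  sum_nonzero (0, - x)%R (a, y) = (x != y).
Proof.
move=> a0; rewrite /sum_nonzero xpair_eqE negb_and (eq_sym 0%R) a0 add0r a0.
by rewrite addrC subr_eq0 (eq_sym y).
Qed.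

Lemma leq_achromatic_sum_nonzero :
  3 * h + 2 <= achromatic_number (@sum_nonzero 'I_n).
Proof.
have -> : 3 * h + 2 = #|color| by rewrite card_sum !card_ord /n; lia.
have sym (u v : 'I_3 * 'I_n) : sum_nonzero u v = sum_nonzero v u.
  by rewrite /sum_nonzero eq_sym (addrC u.1) (addrC u.2).
have adj_zero x y : y != 0%R -> x != y ->
    exists u v, [/\ f u = inl x, f v = inl y & sum_nonzero u v].
  move=> y0 neq_xy; have [a a0 fa] := f_inl y0.
  by exists (0%R, - x)%R, (a, y); split=> //; rewrite sum_nonzero_zero.
have h_neq0 : inZp h != 0%R :> 'I_n.
  by rewrite -val_eqE /= modn_small -?lt0n // /n; lia.
(* The two vertices of color [inr w] have second coordinates differing by h, which is nonzero modulo
   [n], so one of them avoids [x]. *)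
have adj_mixed x (w : 'I_h.+1) :
    exists u v, [/\ f u = inl x, f v = inr w & sum_nonzero u v].
  have [a a0 neq] : exists2 a : 'I_3, a != 0%R & (inZp w - shift a)%R != x.
    have [eq_x | neq_x] := eqVneq (inZp w) x; last first.
      by exists 1%R; rewrite // /shift eqxx subr0.
    exists (- 1)%R; rewrite // eq_x shift_N1.
    by rewrite subr_eq addrC -subr_eq subrr eq_sym.
  exists (0%R, - x)%R, (a, inZp w - shift a)%R; split=> //; first exact: f_inr.
  by rewrite sum_nonzero_zero // eq_sym.
(* Row 1 suffices: 1 + 1 is nonzero in ['I_3], and distinct [w], [w'] at most h have 0 < w + w' <
   n. *)
have adj_inr (w w' : 'I_h.+1) : w != w' ->
    exists u v, [/\ f u = inr w, f v = inr w' & sum_nonzero u v].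
  move=> neq; exists (1, inZp w - shift 1)%R, (1, inZp w' - shift 1)%R.
  split; rewrite ?f_inr // /shift /= !subr0 /sum_nonzero /= xpair_eqE eqxx /=.
  have := ltn_ord w; have := ltn_ord w'.
  rewrite -!val_eqE /= in neq * => lt_w' lt_w.
  rewrite (@modn_small w) ?(@modn_small w') /n; try lia.
  by rewrite neq modn_small; lia.
apply: (@leq_achromatic_number _ _ _ f) => //.
- case=> [x | w]; first by exists (0%R, - x)%R.
  by exists (1, inZp w - shift 1)%R; apply: f_inr.
- move=> [x | w] [y | w'] neq //.
  + have neq_xy : x != y by apply/eqP=> eq_xy; rewrite eq_xy in neq.
    (* The class of [inl 0] is only [(0, 0)], so for [y = 0] the nonzero row must come from the
       other color. *)
    have [y0 | /adj_zero] := eqVneq y 0%R; last exact.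
    rewrite y0 eq_sym in neq_xy *.
    have [|u [v [fu fv euv]]] := adj_zero 0%R x _ neq_xy.
      by rewrite eq_sym.
    by exists v, u; rewrite sym.
  + have [u [v [fu fv euv]]] := adj_mixed y w.
    by exists v, u; rewrite sym.
  + by apply: adj_inr; apply/eqP=> eq_w; rewrite eq_w in neq.
Qed.

End LowerBound.


(** * Transfer by the Chinese remainder theorem *)

Lemma residues_bij N m n : N = m.+1 * n.+1 -> coprime m.+1 n.+1 ->
  bijective (fun x : 'I_N => (inZp x : 'I_m.+1, inZp x : 'I_n.+1)).
Proof.
move=> defN co; apply: inj_card_bij; last by rewrite card_prod !card_ord defN.
move=> x y [xy_m xy_n]; apply/val_inj/eqP => /=.
have := chinese_remainder co x y.
by rewrite xy_m xy_n !eqxx !modn_small // -defN.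
Qed.

Lemma coprime_add_inZp p (x y : nat) : prime p.+1 ->
  coprime p.+1 (x + y) = ((inZp x + inZp y)%R != 0%R :> 'I_p.+1).
Proof. by move=> pr; rewrite prime_coprime // /dvdn -val_eqE /= modnDm. Qed.

Lemma achromatic_number_Zp_3mul h : coprime 3 h.*2.+1 -> prime h.*2.+1 ->
  achromatic_number (unitary_addition_cayley 'Z_(3 * h.*2.+1)) =
  achromatic_number (@sum_nonzero 'I_h.*2.+1).
Proof.
move=> co pr; have gt1 : 1 < 3 * h.*2.+1 by lia.
(* The ordinal behind ['Z_(3 * h.*2.+1)] has the expected size only up to [Zp_cast], hence the
   equation on [N] in [residues_bij]. *)
have bij := residues_bij (Zp_cast gt1) co.
apply: (achromatic_number_iso bij) => x y.
rewrite /unitary_addition_cayley /sum_nonzero (inj_eq (bij_inj bij)).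
(* Reading [x + y] as the image of a natural number turns being a unit into coprimality, which
   splits over the two factors. *)
congr andb; rewrite -[x in LHS]natr_Zp -[y in LHS]natr_Zp -natrD unitZpE //.
by rewrite coprimeMl !coprime_add_inZp.
Qed.

Theorem theorem3 (q : nat) (q_prime : prime q) (q_gt3 : 3 < q) :
  achromatic_number (unitary_addition_cayley 'Z_(3 * q)) = (3 * q + 1) %/ 2.
Proof.
have odd_q : odd q by case: (even_prime q_prime) => //; lia.
have [h h_gt0 def_q] : exists2 h, 0 < h & q = h.*2.+1.
  by exists q./2; [|rewrite -[LHS]odd_double_half odd_q]; lia.
have co : coprime 3 q by rewrite prime_coprime // dvdn_prime2 //; lia.
rewrite def_q in q_prime co *.
rewrite achromatic_number_Zp_3mul //.
apply/eqP; rewrite eqn_leq; apply/andP; split.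
  apply: achromatic_number_leP => k c /complete_coloring_leq.
  by rewrite card_ord /= odd_double => /(_ isT); lia.
(* For q = 2h + 1, (3q + 1) / 2 is exactly 3h + 2. *)
by apply: leq_trans (leq_achromatic_sum_nonzero h_gt0); lia.
Qed.
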